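(* Let $m\geq2$, $q_1,\dots,q_m\geq2$ and $p_1,\dots,p_m\in\mathbb{Z}$ be integers, let $T=\{f_1,\dots,f_m\}$ with $f_i(x)=\frac{x}{q_i}+\frac{p_i}{q_i}$ for $x\in\mathbb{R}$, and let $K_T\subset\mathbb{R}$ be the attractor of $T$. Then for any non-increasing $\psi:\mathbb{N}\to\mathbb{R}_+$, $$\dim_H\Big\{x\in K_T:\ \Big|x-\frac{p}{q}\Big|\leq\psi(q)\ \text{for infinitely many }\frac{p}{q}\in\mathbb{Q}\cap K_T\Big\}\geq\frac{\dim_H K_T}{\max\{1,\delta_\psi\}},$$ where the rationals $\frac pq$ are written in lowest terms.
   Context: $\dim_H$ is Hausdorff dimension. The attractor $K_T$ is the unique non-empty compact set with $K_T=\bigcup_i f_i(K_T)$. $\delta_\psi=\liminf_{q\to+\infty}\frac{-\log\psi(q)}{\log q}$, with the conventions $-\log0=+\infty$ and $c/{+\infty}=0$ for $0\le c<\infty$. *)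

(* Defs.v *)
From mathcomp Require Import all_boot all_order all_algebra.
From mathcomp Require Import all_classical all_reals all_analysis.
Set Implicit Arguments.
Unset Strict Implicit.
Unset Printing Implicit Defensive.

Import Order.TTheory GRing.Theory Num.Theory.
Import numFieldNormedType.Exports.

Local Open Scope classical_set_scope.
Local Open Scope ring_scope.

Section HausdorffDimension.
Context {R : realType}.
Implicit Types (A U : set R) (s d : R).

(* The supremum is -oo when A is empty; [gauge] treats that case apart. *)
Definition diameter A : \bar R :=
  ereal_sup [set `|x - y|%:E | x in A & y in A].

(* diam(U)^s, where the empty set counts for 0 for every s, and a singleton
   counts for 1 when s = 0 (0 `^ 0 = 1), so that s = 0 gives counting measure. *)
Definition gauge s U : \bar R :=
  if `[< U = set0 >] then 0%E else (diameter U `^ s)%E.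

Definition hausdorff_premeasure s d A : \bar R :=
  ereal_inf [set (\sum_(0 <= i <oo) gauge s (U i))%E | U in
    [set U : nat -> set R |
      A `<=` \bigcup_i U i /\ forall i, (diameter (U i) <= d%:E)%E]].

(* The limit as d -> 0+ is a supremum, by monotonicity in d. *)
Definition hausdorff_measure s A : \bar R :=
  ereal_sup [set hausdorff_premeasure s d A | d in [set d | 0 < d]].

Definition hausdorff_dim A : \bar R :=
  ereal_inf [set s%:E | s in [set s | 0 <= s /\ hausdorff_measure s A = 0%E]].

End HausdorffDimension.

Definition is_attractor {R : realType} {I : Type} (f : I -> R -> R)
    (K : set R) : Prop :=
  [/\ K !=set0, compact K & K = \bigcup_i (f i @` K)].

Definition ifs {R : realType} {m : nat} (q : 'I_m -> nat) (p : 'I_m -> int)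
    (i : 'I_m) (x : R) : R :=
  x / (q i)%:R + (p i)%:~R / (q i)%:R.

(* [lne 0 = -oo] gives the convention - log 0 = +oo.  The junk values at
   q = 0, 1, where ln q = 0, do not affect the lower limit. *)
Definition delta {R : realType} (psi : nat -> R) : \bar R :=
  limn_einf (fun q : nat => (- lne (psi q)%:E / (ln q%:R)%:E)%E).

(* A term of type [rat] is a fraction in lowest terms with positive
   denominator [denq r], so distinct fractions are counted once. *)
Definition intrinsically_approximable {R : realType} (psi : nat -> R)
    (K : set R) : set R :=
  [set x | K x /\ infinite_set [set r : rat |
    K (ratr r) /\ `|x - ratr r| <= psi `|denq r|%N]].

(* Main.v *)
Require Import Defs.
From mathcomp Require Import all_boot all_order all_algebra.
From mathcomp Require Import all_classical all_reals all_analysis.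
From mathcomp Require Import zify ring lra.
Set Implicit Arguments.
Unset Strict Implicit.
Unset Printing Implicit Defensive.

Import Order.TTheory GRing.Theory Num.Theory.
Import numFieldNormedType.Exports.

Local Open Scope classical_set_scope.
Local Open Scope ring_scope.

(** The theorem holds because the attractor contains many rationals of small
    denominator, and because the mass transference needed to exploit them can
    be done by hand on a suitable Cantor subset.

    Every finite composition of the maps has the form x |-> (x + b) / Q with Q
    a product of the q_i.  If r0 is the rational fixed point of one such map,
    then its image under a composition of ratio 1 / Q is a rational point of K
    of denominator at most Q times that of r0.  So K has rationals of
    denominator O(Q) within O(1 / Q) of each of its points, and inside every
    copy of K of ratio 1 / Q.  On the other side, delta psi < t provides
    infinitely many N with psi N >= N^-t, and monotonicity of psi turns this
    into a lower bound for psi k that is uniform over all k <= N: the denominator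
    of the approximating rational only has to be bounded above
    ([good_levels]).

    No separation condition is assumed on the maps, so the copies of K may
    overlap.  However, if s1 < dim K then K cannot be covered by few intervals
    of length 1 / A; hence it has about A^s1 points at mutual distance of order
    1 / A, and choosing a copy of K of ratio about 1 / A around each of them
    gives a finite system of maps sending K to well separated subsets, of
    dimension close to dim K ([separated_subsystem]).  Its ratios need not be
    equal, but they lie in [1 / B, 1 / A] with B <= A^(1 + eta), which costs
    only a factor in the exponents that tends to 1 as eta tends to 0.

    Points of K are then coded by digit sequences in this system.  Consider
    the codes which at sparse levels n carry the digit of r0 on the block from
    n to about t n, so that the point lies within N^-t of a rational of
    denominator at most N, where N is about B^n.  The last digit of each block
    is a different one, which keeps the point away from that rational and
    forces the approximations to be infinitely many.  Since the blocks are
    sparse, at least a proportion close to 1 / t of the first n digits is free,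
    for every n ([sparse_blocks]).  The uniform measure on these codes
    therefore satisfies the mass distribution principle with any exponent below
    dim K / t ([hausdorff_measure_neq0]), whence the lower bound.

    The mass distribution principle is proved without constructing a measure.
    Small sets are enclosed in cylinders of the code space, and a code avoiding
    a family of cylinders of total mass less than 1 is built digit by digit
    ([avoid_cylinders]). *)

(** * Avoiding cylinders of small total mass in a tree *)

Section Trees.
Context {R : realType} {I : finType}.
Variable D : nat -> {set I}.
Hypothesis D0 : forall k, D k != finset.set0.

Definition admissible (u : nat -> I) := forall k, u k \in D k.

(** The mass of a cylinder of length n under the uniform measure on admissible
    codes; it depends on n only. *)
Definition branch_weight n : R := \prod_(k < n) (#|D k|%:R)^-1.

Lemma card_digits_gt0 k : 0 < #|D k|%:R :> R.
Proof. by rewrite ltr0n card_gt0 D0. Qed.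

Lemma branch_weight_ge0 n : 0 <= branch_weight n.
Proof. by apply: prodr_ge0 => i _; rewrite invr_ge0 ler0n. Qed.

Lemma branch_weight_split n : branch_weight n = branch_weight n.+1 *+ #|D n|.
Proof.
rewrite /branch_weight big_ord_recr /= -[RHS]mulr_natr -mulrA mulVf ?mulr1 //.
by rewrite gt_eqF // card_digits_gt0.
Qed.

(** The mass of the intersection of the cylinders of w and of v: two cylinders
    are nested or disjoint. *)
Definition cylinder_mass (w v : seq I) : R :=
  if prefix w v || prefix v w then branch_weight (maxn (size w) (size v)) else 0.

Lemma cylinder_mass_ge0 w v : 0 <= cylinder_mass w v.
Proof. by rewrite /cylinder_mass; case: ifP => // _; exact: branch_weight_ge0. Qed.

(** Additivity of the measure over the children of w, as an inequality because
    v may leave the tree of admissible codes. *)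
Lemma cylinder_mass_children w v :
  \sum_(j in D (size w)) cylinder_mass (rcons w j) v <= cylinder_mass w v.
Proof.
have [le_vw|lt_wv] := leqP (size v) (size w).
  have Ej j : cylinder_mass (rcons w j) v =
      if prefix v w then branch_weight (size w).+1 else 0.
    rewrite /cylinder_mass size_rcons.
    have -> : maxn (size w).+1 (size v) = (size w).+1 by apply/maxn_idPl/leqW.
    suff -> : prefix (rcons w j) v || prefix v (rcons w j) = prefix v w by [].
    rewrite !prefixE -cats1 (takel_cat _ le_vw).
    rewrite orbC; case: eqP => //= _; apply/negbTE/eqP => /(congr1 size).
    rewrite size_take size_cat /= addn1 ltnNge leqW //= => Es; move: le_vw.
    by rewrite Es ltnn.
  under eq_bigr do rewrite Ej.
  rewrite /cylinder_mass (maxn_idPl le_vw).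
  case: (prefix v w); rewrite ?orbT ?orbF.
    by rewrite sumr_const (branch_weight_split (size w)).
  rewrite big1 //; case: ifP => // _; exact: branch_weight_ge0.
have [x0 _] : exists x0 : I, true by case: (v) lt_wv => // x0; exists x0.
apply: (@le_trans _ _
  (\sum_(j in D (size w)) if j == nth x0 v (size w) then cylinder_mass w v else 0)).
  apply: ler_sum => j _; rewrite {1}/cylinder_mass size_rcons (maxn_idPr lt_wv).
  case: ifP => [pre|_]; last first.
    by case: ifP => // _; exact: cylinder_mass_ge0.
  have pre' : prefix (rcons w j) v.
    case/orP: pre => //; rewrite prefixE => /eqP Ev.
    have sz : size v = (size w).+1.
      apply/eqP; rewrite eqn_leq lt_wv andbT -Ev size_take size_rcons.
      by case: ltnP => //; lia.
    by rewrite prefixE size_rcons -sz take_size -Ev sz -(size_rcons w j) take_size.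
  case/prefixP: pre' => v' ->.
  rewrite nth_cat size_rcons ltnSn nth_rcons ltnn eqxx eqxx /cylinder_mass.
  rewrite -cats1 -catA prefix_prefix /= size_cat.
  by rewrite (maxn_idPr (leq_addr _ _)).
rewrite -big_mkcondr /=.
have [jD|jD] := boolP (nth x0 v (size w) \in D (size w)).
  by rewrite (big_pred1 (nth x0 v (size w))) // => j /=; case: eqP => [->|]; rewrite ?andbF// jD.
rewrite big_pred0 ?cylinder_mass_ge0 // => j.
by case: eqP => [->|]; rewrite ?andbF// (negbTE jD).
Qed.

(** Greedy choice of the digits: call a word light when the forbidden cylinders
    fill less than all of its own cylinder.  The empty word is light by
    hypothesis, and by averaging over the children a light word has a light
    child.  A code all of whose prefixes are light cannot run through v i,
    because v i fills its own cylinder. *)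
Lemma avoid_cylinders (v : nat -> seq I) :
  (\sum_(0 <= i <oo) (branch_weight (size (v i)))%:E < 1)%E ->
  exists u, admissible u /\ forall i, mkseq u (size (v i)) <> v i.
Proof.
move=> sum_lt1.
pose F w := (\sum_(0 <= i <oo) (cylinder_mass w (v i))%:E)%E.
pose light w := (F w < (branch_weight (size w))%:E)%E.
have /choice[next nextP] : forall w, exists j,
    j \in D (size w) /\ (light w -> light (rcons w j)).
  move=> w; have [j0 j0D] : exists j, j \in D (size w) by exact/set0Pn.
  have [lw|nlw] := pselect (light w); last by exists j0; split.
  apply: contrapT => noj; suff : ~ (F w < (branch_weight (size w))%:E)%E by apply.
  apply/negP; rewrite -leNgt.
  apply: (@le_trans _ _ (\sum_(j in D (size w)) F (rcons w j))%E); last first.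
    rewrite /F -nneseries_sum; last by move=> *; rewrite lee_fin cylinder_mass_ge0.
    apply: lee_nneseries => [i _ _|i _].
      by apply: sume_ge0 => j _; rewrite lee_fin cylinder_mass_ge0.
    by rewrite sumEFin lee_fin cylinder_mass_children.
  rewrite branch_weight_split -sumr_const -sumEFin.
  apply: lee_sum => j jD; rewrite leNgt; apply/negP => lj; apply: noj.
  by exists j; split=> // _; rewrite /light size_rcons.
pose word := fix word n :=
  if n is n'.+1 then rcons (word n') (next (word n')) else [::].
have size_word n : size (word n) = n.
  by elim: n => //= n IH; rewrite size_rcons IH.
pose u n := next (word n).
have wordE n : word n = mkseq u n.
  by elim: n => //= n IH; rewrite mkseqS {1}IH.
have light_word n : light (word n).
  elim: n => [|n IH]; last exact: (nextP _).2 IH.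
  suff F0 : F [::] = (\sum_(0 <= i <oo) (branch_weight (size (v i)))%:E)%E.
    by rewrite /light F0 /= {2}/branch_weight big_ord0.
  by apply: eq_eseriesr => i _; rewrite /cylinder_mass prefix0s max0n.
exists u; split=> [k|i Ei].
  by have [+ _] := nextP (word k); rewrite size_word.
have := light_word (size (v i)); rewrite wordE Ei /light ltNge => /negP; apply.
have ge0 k : (0 <= (cylinder_mass (v i) (v k))%:E)%E by rewrite lee_fin cylinder_mass_ge0.
apply: (@le_trans _ _ (\sum_(0 <= k < i.+1) (cylinder_mass (v i) (v k))%:E)%E).
  2: exact: nneseries_lim_ge.
rewrite big_nat_recr //= -[leLHS]add0e leeD //; first exact: sume_ge0.
by rewrite /cylinder_mass prefix_refl maxnn.
Qed.

End Trees.

(** * The mass distribution principle *)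

Section HausdorffLemmas.
Context {R : realType}.
Implicit Types (A U : set R) (s d : R).

Lemma le_diameter U x y : U x -> U y -> (`|x - y|%:E <= diameter U)%E.
Proof. by move=> Ux Uy; apply: ereal_sup_ubound; exists x => //; exists y. Qed.

Lemma gauge_fin U s d x : U x -> (diameter U <= d%:E)%E ->
  exists r, [/\ 0 <= r, diameter U = r%:E & gauge s U = (r `^ s)%:E].
Proof.
move=> Ux Ud; have U0 : (0%:E <= diameter U)%E.
  by have := le_diameter Ux Ux; rewrite subrr normr0.
have fd : diameter U \is a fin_num.
  by rewrite ge0_fin_numE // (le_lt_trans Ud) // ltry.
exists (fine (diameter U)); split; first exact: fine_ge0.
- by rewrite fineK.
- rewrite /gauge asboolF; last by move=> UE; rewrite UE in Ux.
  by rewrite -{1}(fineK fd) poweR_EFin.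
Qed.

Lemma gauge_ge0 U s : (0 <= gauge s U)%E.
Proof. by rewrite /gauge; case: asbool => //; exact: poweR_ge0. Qed.

Lemma hausdorff_dim_ge A (L : \bar R) :
  (forall s, 0 <= s -> hausdorff_measure s A = 0%E -> (L <= s%:E)%E) ->
  (L <= hausdorff_dim A)%E.
Proof. by move=> h; apply: le_ereal_inf_tmp => _ [s [s0 Hs]] <-; exact: h. Qed.

Lemma hausdorff_measure0_cover A s (e : R) : 0 < e -> hausdorff_measure s A = 0%E ->
  exists U : nat -> set R, [/\ A `<=` \bigcup_i U i,
    forall i, (diameter (U i) <= 1%:E)%E &
    (\sum_(0 <= i <oo) gauge s (U i) < e%:E)%E].
Proof.
move=> e0 H0.
have : (hausdorff_premeasure s 1 A < e%:E)%E.
  apply: (@le_lt_trans _ _ 0%E); last by rewrite lte_fin.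
  by rewrite -H0; apply: ereal_sup_ubound; exists 1 => //=.
by move=> /ereal_inf_lt[_ [U [AU dU] <-] ltU]; exists U.
Qed.

End HausdorffLemmas.

(** Points pt u are coded so that codes first differing at position n give
    points at distance at least kappa / B^n, and a cylinder of length n has mass
    at most (B^n)^-s. *)
Section MassDistribution.
Context {R : realType} {I : finType}.
Variables (D : nat -> {set I}) (pt : (nat -> I) -> R) (A : set R).
Variables (B : nat) (kappa s : R).
Hypothesis D0 : forall k, D k != finset.set0.
Hypothesis B_ge2 : (2 <= B)%N.
Hypothesis kappa_gt0 : 0 < kappa.
Hypothesis s_ge0 : 0 <= s.
Hypothesis sep : forall u v n, admissible D u -> admissible D v ->
  (forall k, (k < n)%N -> u k = v k) -> u n <> v n ->
  kappa / B%:R ^+ n <= `|pt u - pt v|.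
Hypothesis ptA : forall u, admissible D u -> A (pt u).
Hypothesis weight_le : forall n,
  branch_weight D n <= (((B%:R : R) ^+ n) `^ s)^-1.
Hypothesis weight_cvg0 : forall e : R, 0 < e -> exists n, branch_weight D n <= e.

(** If kappa / B^n is the first such scale below the diameter of U, then by
    separation all points coded in U share their first n digits, and that
    cylinder has mass at most (B^n)^-s, hence at most (diameter U / kappa)^s.
    The error e takes care of sets of diameter 0, which need a deep cylinder. *)
Lemma small_set_in_cylinder (U : set R) (d e : R) :
  (diameter U <= d%:E)%E -> 0 < e ->
  exists w : seq I,
    ((branch_weight D (size w))%:E <= (kappa `^ s)^-1%:E * gauge s U + e%:E)%E /\
    forall u, admissible D u -> U (pt u) -> mkseq u (size w) = w.
Proof.
move=> dU e0.
have ge0 : (0 <= (kappa `^ s)^-1%:E * gauge s U)%E.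
  by rewrite mule_ge0 ?gauge_ge0 // lee_fin invr_ge0 powR_ge0.
have [n0 n0e] := weight_cvg0 e0.
have n0le : ((branch_weight D n0)%:E <= (kappa `^ s)^-1%:E * gauge s U + e%:E)%E.
  by rewrite -[leLHS]add0e leeD // lee_fin.
have [[u0 [u0D u0U]]|noU] := pselect (exists u, admissible D u /\ U (pt u));
    last first.
  have [i0 _] : exists i, i \in D 0 by exact/set0Pn.
  exists (nseq n0 i0); rewrite size_nseq; split=> // u uD uU.
  by case: noU; exists u.
have [r [r0 rE gE]] := gauge_fin s u0U dU.
have [n [ltn wn]] : exists n, (forall k, (k < n)%N -> r < kappa / B%:R ^+ k) /\
    ((branch_weight D n)%:E <= (kappa `^ s)^-1%:E * gauge s U + e%:E)%E.
  have [r_eq0|rN0] := eqVneq r 0.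
    exists n0; split=> // k _; rewrite r_eq0 divr_gt0 // exprn_gt0 // ltr0n.
    exact: leq_trans B_ge2.
  have rgt0 : 0 < r by rewrite lt_def rN0.
  have exn : exists n, kappa / B%:R ^+ n <= r.
    exists (Num.truncn (kappa / r)).+1; rewrite ler_pdivrMr; last first.
      by rewrite exprn_gt0 // ltr0n; exact: leq_trans B_ge2.
    rewrite mulrC -ler_pdivrMr // (le_trans (ltW (truncnS_gt _))) //.
    by rewrite -natrX ler_nat ltnW // ltn_expl.
  exists (ex_minn exn); case: ex_minnP => n nr nmin; split=> [k kn|].
    by rewrite ltNge; apply/negP => /nmin; rewrite leqNgt kn.
  rewrite gE -EFinM -EFinD lee_fin (le_trans (weight_le n)) //.
  rewrite -[leLHS]addr0 lerD ?(ltW e0) //.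
  have Bn0 : 0 < B%:R ^+ n :> R by rewrite exprn_gt0 // ltr0n; exact: leq_trans B_ge2.
  rewrite mulrC ler_pdivlMr ?powR_gt0 // mulrC ler_pdivrMr ?powR_gt0 //.
  rewrite -powRM ?(ltW Bn0) //; apply: ge0_ler_powR => //.
  - by rewrite nnegrE ltW.
  - by rewrite nnegrE mulr_ge0 // ltW.
  - by rewrite -ler_pdivrMr.
exists (mkseq u0 n); rewrite size_mkseq; split=> // u uD uU.
apply: contrapT => neq.
have exk : exists k, (k < n)%N && (u k != u0 k).
  apply: contrapT => nok; apply: neq; apply/eq_in_map => k; rewrite mem_iota /= => kn.
  by apply: contrapT => /eqP ukn; apply: nok; exists k; rewrite kn.
case: (ex_minnP exk) => k /andP[kn /eqP uk] kmin.
have := @sep u u0 k uD u0D _ uk => /(_ _)/wrap[].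
  move=> j jk; apply: contrapT => /eqP uj.
  by have := kmin j; rewrite uj (ltn_trans jk kn) leqNgt jk => /(_ isT).
rewrite leNgt => /negP; apply; apply: le_lt_trans (ltn _ kn).
by rewrite -lee_fin -rE; exact: le_diameter.
Qed.

(** A cover of total gauge less than kappa^s / 3 would yield cylinders of total
    mass less than 1 containing all admissible codes. *)
Lemma hausdorff_measure_neq0 : hausdorff_measure s A <> 0%E.
Proof.
move=> H0.
have k0 : 0 < kappa `^ s by rewrite powR_gt0.
have e0 : 0 < kappa `^ s / 3 by rewrite divr_gt0.
have [U [AU dU sumU]] := hausdorff_measure0_cover e0 H0.
have e3 i : 0 < 1 / 3 / (2 ^ i.+1)%:R :> R by rewrite !divr_gt0 // ltr0n expn_gt0.
have /choice[w wP] := fun i : nat => small_set_in_cylinder (dU i) (e3 i).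
have [|u [uD uw]] := @avoid_cylinders R I D D0 w.
  apply: (@le_lt_trans _ _ ((kappa `^ s)^-1%:E * (\sum_(0 <= i <oo) gauge s (U i)) + (1/3)%:E)%E).
    rewrite -nneseriesZl; last by move=> *; exact: gauge_ge0.
    apply: le_trans (epsilon_trick _ _ _) => //.
    - apply: lee_nneseries => [i _ _|i _]; last by have [] := wP i.
      by rewrite lee_fin; exact: branch_weight_ge0.
    - by move=> i; rewrite mule_ge0 ?gauge_ge0 // lee_fin invr_ge0 ltW.
  apply: (@lt_le_trans _ _ ((kappa `^ s)^-1%:E * (kappa `^ s / 3)%:E + (1/3)%:E)%E).
    rewrite lteD2rE // lte_pmul2l // lte_fin invr_gt0 //.
  rewrite -EFinM -EFinD lee_fin mulrA mulVf ?gt_eqF //; lra.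
have [i _ Ui] := AU _ (ptA uD).
by apply: (uw i); have [_] := wP i; apply.
Qed.

End MassDistribution.

(** * Covering numbers and separated subsystems *)

Section CoveringNumbers.
Context {R : realType}.
Implicit Types (A U : set R) (s d : R).

Definition covered_by A (rho : R) (xs : seq R) :=
  forall x, A x -> exists2 y, y \in xs & `|x - y| <= rho.

(** A finite cover is admissible in the definition of the premeasure, and for
    some d the premeasure is positive since s is below the dimension. *)
Lemma dim_lt_covering A s : 0 <= s -> (s%:E < hausdorff_dim A)%E ->
  exists c d : R, [/\ 0 < c, 0 < d &
    forall xs rho, 0 < rho -> 2 * rho <= d -> covered_by A rho xs ->
      c <= (size xs)%:R * (2 * rho) `^ s].
Proof.
move=> s0 sA.
have HN0 : hausdorff_measure s A <> 0%E.
  move=> H0; move: sA; rewrite ltNge => /negP; apply.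
  by apply: ereal_inf_lbound; exists s.
have [d [d0 Pd]] : exists d, 0 < d /\ (0 < hausdorff_premeasure s d A)%E.
  apply: contrapT => no; apply: HN0; apply/eqP; rewrite eq_le; apply/andP; split.
    apply: ge_ereal_sup => _ [d d0 <-]; rewrite leNgt; apply/negP => dpos.
    by apply: no; exists d.
  apply: (@le_trans _ _ (hausdorff_premeasure s 1 A)).
    apply: le_ereal_inf_tmp => _ [U _ <-]; apply: nneseries_ge0 => i _ _.
    exact: gauge_ge0.
  by apply: ereal_sup_ubound; exists 1 => //=.
have [c [c0 cP]] : exists c : R, 0 < c /\ (c%:E <= hausdorff_premeasure s d A)%E.
  case: (hausdorff_premeasure s d A) Pd => [r| |] //.
    by rewrite lte_fin => r0; exists r.
  by move=> _; exists 1; split=> //; exact: leey.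
exists c, d; split=> // xs rho rho0 rhod cov.
pose U i : set R := if (i < size xs)%N then [set x | `|x - nth 0 xs i| <= rho] else set0.
have dU i : (diameter (U i) <= (2 * rho)%:E)%E.
  apply: ge_ereal_sup => _ [x Ux [y Uy <-]]; rewrite lee_fin.
  move: Ux Uy; rewrite /U; case: ifP => //= _ hx hy.
  rewrite (_ : x - y = (x - nth 0 xs i) - (y - nth 0 xs i)); last by ring.
  by rewrite (le_trans (ler_normB _ _)) // mulr_natl mulr2n lerD.
have gU i : (gauge s (U i) <= if (i < size xs)%N then ((2 * rho) `^ s)%:E else 0)%E.
  case: ifP => [ik|ik]; last by rewrite /gauge asboolT // /U ik.
  have Ux : U i (nth 0 xs i) by rewrite /U ik /= subrr normr0 ltW.
  have [r [r0 rE ->]] := gauge_fin s Ux (dU i).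
  rewrite lee_fin ge0_ler_powR // ?nnegrE ?mulr_ge0 // ?(ltW rho0) //.
  by rewrite -lee_fin -rE.
rewrite -lee_fin; apply: le_trans cP _; apply: (@le_trans _ _ (\sum_(0 <= i <oo) gauge s (U i))%E).
  apply: ereal_inf_lbound; exists U => //; split=> [x Ax|i].
    have [y yxs xy] := cov x Ax; exists (index y xs) => //.
    by rewrite /U index_mem yxs /= nth_index.
  by apply: le_trans (dU i) _; rewrite lee_fin.
have g0 i : (0 <= i)%N -> (0 <= gauge s (U i))%E by move=> _; exact: gauge_ge0.
rewrite (nneseries_split 0 (size xs) g0).
have tail0 : (\sum_(size xs <= i <oo) gauge s (U i) = 0)%E.
  by apply: eseries0 => i ik _; rewrite /gauge asboolT // /U ltnNge ik.
rewrite add0n tail0 adde0.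
apply: (@le_trans _ _ (\sum_(0 <= i < size xs) ((2 * rho) `^ s)%:E)%E).
  rewrite big_nat_cond [leRHS]big_nat_cond; apply: lee_sum => i /andP[/andP[_ ik] _].
  by have := gU i; rewrite ik.
by rewrite sumEFin lee_fin sumr_const_nat subn0 [leRHS]mulr_natl.
Qed.

(** A separated family that cannot be extended is the set of centres of a
    cover. *)
Lemma separated_or_covered A (rho : R) M :
  (exists xs : seq R, [/\ size xs = M, {in xs, forall x, A x} &
     pairwise (fun x y => rho < `|x - y|) xs]) \/
  (exists xs : seq R, (size xs <= M)%N /\ covered_by A rho xs).
Proof.
elim: M => [|M [[xs [sz xsA sep]]|[xs [sz cov]]]]; first by left; exists [::].
- have [cov|ncov] := pselect (covered_by A rho xs).
    by right; exists xs; rewrite sz leqnSn.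
  have [x [Ax far]] : exists x, A x /\ forall y, y \in xs -> rho < `|x - y|.
    apply: contrapT => no; apply: ncov => x Ax; apply: contrapT => nox; apply: no.
    exists x; split=> // y yxs; rewrite ltNge; apply/negP => xy.
    by apply: nox; exists y.
  left; exists (x :: xs); split=> /=; first by rewrite sz.
    by move=> y; rewrite inE => /orP[/eqP->|/xsA].
  by rewrite sep andbT; apply/allP => y /far.
- by right; exists xs; split=> //; exact: leqW.
Qed.

End CoveringNumbers.

Section AffineMaps.

Definition affine {F : fieldType} (Q : nat) (b : int) (x : F) : F :=
  (x + b%:~R) / Q%:R.

Lemma affineB {F : fieldType} Q b (x y : F) :
  affine Q b x - affine Q b y = (x - y) / Q%:R.
Proof. by rewrite /affine -mulrBl; congr (_ / _); ring. Qed.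

Lemma affine_comp {F : numFieldType} Q b Q' b' (x : F) : (0 < Q')%N ->
  affine Q b (affine Q' b' x) = affine (Q * Q') (b' + b * Q'%:Z) x.
Proof.
move=> Q'0; have Q'n0 : Q'%:R != 0 :> F by rewrite pnatr_eq0 -lt0n.
rewrite /affine natrM invfM rmorphD rmorphM /= -pmulrn.
rewrite [_^-1 * _^-1]mulrC mulrA; congr (_ * _).
by rewrite addrA !mulrDl mulfK.
Qed.

End AffineMaps.

Lemma powR_unbounded {R : realType} (eta C : R) : 0 < eta ->
  exists A0 : nat, forall A : nat, (A0 <= A)%N -> C <= A%:R `^ eta.
Proof.
move=> eta0; pose t := `|C| `^ eta^-1.
exists (Num.truncn t).+1 => A tA; apply: le_trans (ler_norm C) _.
have -> : `|C| = t `^ eta by rewrite /t -powRrM mulVf ?gt_eqF // powRr1.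
apply: ge0_ler_powR; rewrite ?nnegrE ?powR_ge0 ?ler0n ?(ltW eta0) //.
by apply: le_trans (ltW (truncnS_gt t)) _; rewrite ler_nat.
Qed.

Lemma exists_nat_ge4 (n1 n2 n3 n4 : nat) :
  exists n, [/\ (n1 <= n)%N, (n2 <= n)%N, (n3 <= n)%N & (n4 <= n)%N].
Proof. by exists (n1 + n2 + n3 + n4)%N; split; lia. Qed.

Section Subsystems.
Context {R : realType} {m : nat}.
Variables (q : 'I_m -> nat) (p : 'I_m -> int) (K : set R).
Hypothesis q_ge2 : forall i, (2 <= q i)%N.
Hypothesis hK : is_attractor (ifs q p) K.

Lemma attractor_closed i x : K x -> K (affine (q i) (p i) x).
Proof.
case: hK => _ _ KE Kx; rewrite KE; exists i => //; exists x => //.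
by rewrite /ifs /affine mulrDl.
Qed.

Lemma attractor_piece x : K x -> exists i y, K y /\ x = affine (q i) (p i) y.
Proof.
case: hK => _ _ KE; rewrite {1}KE => -[i _ [y Ky <-]]; exists i, y.
by split=> //; rewrite /ifs /affine mulrDl.
Qed.

(** Compose the maps along a coding of x, stopping as soon as the ratio is
    at most 1 / A.  The recursion keeps only the pair (Q, b) describing the
    composition; k bounds the number of steps left, as each one increases Q. *)
Lemma attractor_copy_at_scale (qm A : nat) x : (forall i, (q i <= qm)%N) ->
  (0 < A)%N -> K x ->
  exists Q b y, [/\ (A <= Q <= A * qm)%N, forall z, K z -> K (affine Q b z), K y &
    x = affine Q b y].
Proof.
move=> qm_ge A0 Kx.
have [i0 _] := attractor_piece Kx.
have qm2 : (2 <= qm)%N by exact: leq_trans (q_ge2 i0) (qm_ge i0).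
suff : forall k Q b y, (A <= Q + k)%N -> (0 < Q <= A * qm)%N ->
    (forall z, K z -> K (affine Q b z)) -> K y -> x = affine Q b y ->
    exists Q b y, [/\ (A <= Q <= A * qm)%N, forall z, K z -> K (affine Q b z), K y &
    x = affine Q b y].
  have id1 (z : R) : affine 1 0 z = z by rewrite /affine addr0 divr1.
  move=> /(_ A 1%N 0 x); apply; rewrite ?id1 // ?leq_addl //; first by nia.
  by move=> z; rewrite id1.
elim=> [|k IH] Q b y AQk /andP[Q0 Qqm] stab Ky xE.
  by exists Q, b, y; split=> //; rewrite -(addn0 Q) AQk addn0.
have [AQ|QA] := leqP A Q; first by exists Q, b, y; rewrite AQ.
have [i [z [Kz yE]]] := attractor_piece Ky.
have qi0 : (0 < q i)%N by exact: leq_trans (q_ge2 i).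
apply: (IH (Q * q i)%N (p i + b * (q i)%:Z) z) => //.
- by have := q_ge2 i; nia.
- by rewrite muln_gt0 Q0 qi0 /= leq_mul // ltnW.
- by move=> t Kt; rewrite -affine_comp //; apply/stab/attractor_closed.
- by rewrite -affine_comp // -yE.
Qed.

(** Copies of K of ratio at most 1 / A around points at mutual distance
    5 Dm / A stay Dm / A apart, and M = A^s2 such points exist because a cover
    by M intervals of length 10 Dm / A would contradict [dim_lt_covering] once
    A^(s1 - s2) is large.  Taking A large also absorbs the factor max q between
    A and B into the power A^eta. *)
Lemma separated_subsystem (s1 s2 eta Dm : R) :
  0 <= s2 -> s2 < s1 -> (s1%:E < hausdorff_dim K)%E -> 0 < eta -> 0 < Dm ->
  (forall x y, K x -> K y -> `|x - y| <= Dm) ->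
  exists (A B M : nat) (Q : 'I_M -> nat) (b : 'I_M -> int) (kappa : R),
  [/\ (2 <= A <= B)%N, B%:R <= A%:R `^ (1 + eta) :> R,
      (2 <= M)%N /\ A%:R `^ s2 <= M%:R,
      forall j, (A <= Q j <= B)%N /\ (forall x, K x -> K (affine (Q j) (b j) x)) &
      0 < kappa /\ forall i j x y, i != j -> K x -> K y ->
        kappa <= `|affine (Q i) (b i) x - affine (Q j) (b j) y| ].
Proof.
move=> s2_ge0 s21 s1K eta0 Dm0 KD.
have s1_ge0 : 0 <= s1 by rewrite (le_trans s2_ge0) // ltW.
have [c [d [c0 d0 cov]]] := dim_lt_covering s1_ge0 s1K.
pose qm := (\max_(i < m) q i)%N.
have qm_ge i : (q i <= qm)%N by exact: leq_bigmax.
have [A1 hA1] := powR_unbounded qm%:R eta0.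
have s12 : 0 < s1 - s2 by rewrite subr_gt0.
have [A2 hA2] := powR_unbounded (2 * (10 * Dm) `^ s1 / c + 1) s12.
have [A3 hA3] := powR_unbounded (10 * Dm / d) ltr01.
have [A [A_ge2 AA1 AA2 AA3]] := exists_nat_ge4 2 A1 A2 A3.
have A_ge1 : (1 <= A)%N by exact: ltnW.
have Ar : 0 < A%:R :> R by rewrite ltr0n.
pose M := (Num.truncn (A%:R `^ s2 : R)).+1.
have As2 : 1 <= A%:R `^ s2 :> R.
  by rewrite -[leLHS](powRr0 (A%:R : R)); apply: ler_powR => //; rewrite ler1n.
have AM : A%:R `^ s2 <= M%:R :> R by exact: ltW (truncnS_gt _).
have MA : M%:R <= 2 * A%:R `^ s2 :> R.
  rewrite /M -natr1 mulr_natl mulr2n lerD // truncn_le; exact: powR_ge0.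
pose rho := 5 * Dm / A%:R.
have rho0 : 0 < rho by rewrite divr_gt0 // mulr_gt0.
have rho2 : 2 * rho = 10 * Dm / A%:R by rewrite /rho; field; rewrite gt_eqF.
have [[xs [sz xsK sep]]|[xs [sz covK]]] := separated_or_covered K rho M; last first.
  exfalso; have := cov xs rho rho0.
  rewrite rho2 => /(_ _ covK)/wrap[].
    rewrite ler_pdivrMr // -ler_pdivrMl // mulrC.
    by have := hA3 A AA3; rewrite powRr1 // ler0n.
  apply/negP; rewrite -ltNge.
  have := hA2 A AA2; rewrite powRB ?(gt_eqF Ar) ?implybT //.
  have : (10 * Dm / A%:R) `^ s1 * A%:R `^ s1 = (10 * Dm) `^ s1.
    rewrite -powRM ?divfK ?(gt_eqF Ar) // ?(ltW Ar) //.
    by rewrite divr_ge0 ?(ltW Ar) // mulr_ge0 // ltW.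
  have Y0 : 0 < A%:R `^ s1 :> R by exact: powR_gt0.
  have X0 : 0 <= (10 * Dm / A%:R) `^ s1 by exact: powR_ge0.
  move: As2 MA Y0 X0; set X := (10 * Dm / _) `^ s1; set Y := A%:R `^ s1.
  set Z := A%:R `^ s2 => Z1 MZ Y0 X0 <- hc.
  apply: (@le_lt_trans _ _ (2 * Z * X)).
    by apply: ler_wpM2r => //; apply: le_trans MZ; rewrite ler_nat.
  have hlt : 2 * (X * Y) / c < Y / Z by lra.
  have Z0 : 0 < Z by lra.
  rewrite ltr_pdivlMr // in hlt.
  have : 2 * (X * Y) / c * Z = 2 * Z * X * (Y / c) by ring.
  move=> e; rewrite {}e mulrA ltr_pdivrMr // [Y * c]mulrC ltr_pM2r // in hlt.
have xs_nth (j : 'I_M) : K (nth 0 xs j) by apply: xsK; rewrite mem_nth // sz.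
have /choice[f fP] := fun j => attractor_copy_at_scale qm_ge (ltnW A_ge2) (xs_nth j).
have /choice[g gP] := fP; have /choice[y yP] := gP.
exists A, (A * qm)%N, M, f, g, (Dm / A%:R); split.
- rewrite A_ge2 leq_pmulr //; case: hK => -[x0 Kx0] _ _.
  have [i0 _] := attractor_piece Kx0.
  exact: leq_trans (ltnW (q_ge2 i0)) (qm_ge i0).
- rewrite natrM powRD ?powRr1 ?ler0n // ?(gt_eqF Ar) ?implybT //.
  by rewrite ler_wpM2l // ?ler0n // hA1.
- by rewrite /M ltnS truncn_gt0.
- by move=> j; have [] := yP j.
- split; first by rewrite divr_gt0.
  move=> i j x z ij Kx Kz.
  have [/andP[Ai _] _ Ky yE] := yP i; have [/andP[Aj _] _ Ky' yE'] := yP j.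
  have close k u v : K u -> K v -> (A <= f k)%N -> 
      `|affine (f k) (g k) u - affine (f k) (g k) v| <= Dm / A%:R.
    move=> Ku Kv Ak; rewrite affineB normrM normfV normr_nat.
    have fk0 : 0 < (f k)%:R :> R by rewrite ltr0n (leq_trans A_ge1).
    apply: ler_pM => //; first exact: KD.
    by rewrite lef_pV2 ?posrE // ler_nat.
  have c1 := close i x (y i) Kx Ky Ai; have c2 := close j z (y j) Kz Ky' Aj.
  rewrite -yE in c1; rewrite -yE' in c2.
  have : rho < `|nth 0 xs i - nth 0 xs j|.
    move/(pairwiseP 0): sep => sep; have [ij'|ji|] := ltngtP i j.
    - by apply: sep; rewrite ?inE ?sz.
    - by rewrite distrC; apply: sep; rewrite ?inE ?sz.
    - by move/val_inj => e; rewrite e eqxx in ij.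
  have -> : rho = 5 * (Dm / A%:R) by rewrite /rho mulrA.
  move: c1 c2; set a := affine _ _ x; set a' := affine _ _ z.
  set e := Dm / A%:R; set u := nth _ _ _; set v := nth _ _ _ => c1 c2.
  have : 0 < e by rewrite divr_gt0.
  have := ler_distD a u v; have := ler_distD a' a v.
  rewrite (distrC u a); lra.
Qed.

End Subsystems.

(** * Words, coded points and rational points *)

Section Words.
Context {I : eqType}.
Variables (Q : I -> nat) (b : I -> int).

(** Stated over any field, so that the same word acts on the rationals and on
    the reals, compatibly with the embedding ([ratr_word_map]). *)
Definition word_map {F : fieldType} (w : seq I) (x : F) : F :=
  foldr (fun i y => affine (Q i) (b i) y) x w.

Definition word_den (w : seq I) : nat := (\prod_(i <- w) Q i)%N.

Lemma word_map_cat {F : fieldType} w w' (x : F) :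
  word_map (w ++ w') x = word_map w (word_map w' x).
Proof. exact: foldr_cat. Qed.

Lemma word_map_rcons {F : fieldType} w i (x : F) :
  word_map (rcons w i) x = word_map w (affine (Q i) (b i) x).
Proof. exact: foldr_rcons. Qed.

Lemma word_mapB {F : fieldType} w (x y : F) :
  word_map w x - word_map w y = (x - y) / (word_den w)%:R.
Proof.
rewrite /word_den; elim: w => [|i w IH] /=; first by rewrite big_nil divr1.
by rewrite affineB IH big_cons natrM invfM mulrA mulrAC.
Qed.

Lemma ratr_word_map {R : realType} w (r : rat) :
  ratr (word_map w r) = word_map w (ratr r) :> R.
Proof.
elim: w => //= i w IH.
by rewrite /affine fmorph_div rmorphD /= ratr_int ratr_nat IH.
Qed.

Lemma denq_le (r : rat) (d : nat) : (0 < d)%N -> r * d%:R \is a Num.int ->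
  (`|denq r| <= d)%N.
Proof.
move=> d0 /intrP[n rn]; apply: dvdn_leq => //.
have E : numq r * d%:Z = n * denq r.
  apply/eqP; rewrite -(eqr_int rat) !rmorphM /= -rn mulrAC.
  by rewrite -{2}(divq_num_den r) divfK // intr_eq0 denq_neq0.
have : (denq r %| numq r * d%:Z)%Z by rewrite E dvdz_mull.
by rewrite Gauss_dvdzr // /coprimez gcdzC; apply: coprime_num_den.
Qed.

(** Multiplying by word_den w undoes the divisions made by word_map w. *)
Lemma denq_word_map w (r : rat) : (forall i, (0 < Q i)%N) ->
  (`|denq (word_map w r)| <= `|denq r| * word_den w)%N.
Proof.
move=> Q0; apply: denq_le.
  by rewrite muln_gt0 absz_gt0 denq_neq0 prodn_gt0.
rewrite /word_den; elim: w => [|i w IH] /=.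
  have -> : (`|denq r| * \prod_(j <- [::]) Q j)%N%:R = (denq r)%:~R :> rat.
    by rewrite big_nil muln1 -[in RHS](gtz0_abs (denq_gt0 r)).
  by rewrite -{1}(divq_num_den r) divfK ?intr_eq0 ?denq_neq0 // intr_int.
have Qi : (Q i)%:R != 0 :> rat by rewrite pnatr_eq0 -lt0n.
rewrite big_cons mulnCA natrM mulrA /affine divfK // mulrDl rpredD //.
by rewrite rpredM ?intr_int ?natr_int.
Qed.

End Words.

Section Codes.
Context {R : realType} {I : finType}.
Variables (Q : I -> nat) (b : I -> int) (K : set R) (A B : nat) (Dm : R).
Hypothesis K0 : K !=set0.
Hypothesis Kc : compact K.
Hypothesis KD : forall x y, K x -> K y -> `|x - y| <= Dm.
Hypothesis A_ge2 : (2 <= A)%N.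
Hypothesis QAB : forall i, (A <= Q i <= B)%N.
Hypothesis stable : forall i x, K x -> K (affine (Q i) (b i) x).

Lemma ratio_gt0 i : (0 < Q i)%N.
Proof.
have /andP[AQ _] := QAB i; apply: leq_trans AQ; exact: ltnW.
Qed.

Lemma word_den_bounds w : (A ^ size w <= word_den Q w <= B ^ size w)%N.
Proof.
rewrite /word_den; elim: w => [|i w /andP[h1 h2]]; first by rewrite big_nil.
have /andP[AQ QB] := QAB i.
by rewrite big_cons /= !expnS !leq_mul.
Qed.

Lemma word_den_gt0 w : (0 < word_den Q w)%N.
Proof. by rewrite prodn_gt0 // => i; exact: ratio_gt0. Qed.

Lemma word_map_stable w x : K x -> K (word_map Q b w x).
Proof. by move=> Kx; elim: w => //= i w IH; exact: stable. Qed.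

Definition coded (u : nat -> I) (x : R) :=
  forall n, exists y, K y /\ x = word_map Q b (mkseq u n) y.

Lemma mkseqD (u : nat -> I) n k :
  mkseq u (n + k) = mkseq u n ++ mkseq (fun j => u (n + j)%N) k.
Proof.
by rewrite /mkseq iotaD map_cat add0n -{2}[n]addn0 iotaDl -map_comp.
Qed.

Lemma word_map_continuous w : continuous (word_map Q b w : R -> R).
Proof.
have E : (word_map Q b w : R -> R) =
    (fun x => x * (word_den Q w)%:R^-1 + word_map Q b w 0).
  apply/funext => x; apply/eqP; rewrite -subr_eq; apply/eqP.
  by rewrite word_mapB subr0.
rewrite E => x; apply: cvgD; last exact: cvg_cst.
by apply: cvgM; [exact: cvg_id|exact: cvg_cst].
Qed.

(** The sets word_map (mkseq u n) K are compact and decrease with n; a cluster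
    point of images of an arbitrary point of K lies in all of them. *)
Lemma exists_coded (u : nat -> I) : exists x, coded u x.
Proof.
have [x0 Kx0] := K0.
pose a n := word_map Q b (mkseq u n) x0.
have aK : (a @ \oo) K by exists 0%N => // n _; exact: word_map_stable.
have [x [Kx clx]] := Kc _ aK.
exists x => n.
have cl : closed (word_map Q b (mkseq u n) @` K).
  apply: compact_closed; first exact: Rhausdorff.
  apply: continuous_compact => //; apply: continuous_subspaceT.
  exact: word_map_continuous.
have : (word_map Q b (mkseq u n) @` K) x.
  apply: cl => V Vx; have tail : (a @ \oo) (word_map Q b (mkseq u n) @` K).
    exists n => // k /= nk; rewrite /a -(subnKC nk) mkseqD word_map_cat.
    by eexists (word_map Q b _ x0) => //; exact: word_map_stable.
  by have [z [z1 z2]] := clx _ _ tail Vx; exists z.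
by case=> y Ky <-; exists y.
Qed.

Lemma coded_in u x : coded u x -> K x.
Proof. by move=> /(_ 0%N)[y [Ky ->]]. Qed.

Lemma word_map_close w x y : K x -> K y ->
  `|word_map Q b w x - word_map Q b w y| <= Dm / A%:R ^+ size w.
Proof.
move=> Kx Ky; rewrite word_mapB normrM normfV normr_nat.
have d0 : 0 < (word_den Q w)%:R :> R by rewrite ltr0n word_den_gt0.
apply: ler_pM => //; first exact: KD.
have [/andP[h _]] := word_den_bounds w.
by rewrite -natrX lef_pV2 ?posrE ?ltr0n ?word_den_gt0 ?expn_gt0 ?(ltnW A_ge2) // ler_nat.
Qed.

(** The common prefix is a similarity of ratio at least 1 / B^n, applied to
    points lying in the images of K under two distinct maps. *)
Lemma coded_separated (kappa : R) u v x y n : 0 < kappa ->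
  (forall i j x y, i != j -> K x -> K y ->
     kappa <= `|affine (Q i) (b i) x - affine (Q j) (b j) y|) ->
  coded u x -> coded v y -> (forall k, (k < n)%N -> u k = v k) -> u n <> v n ->
  kappa / B%:R ^+ n <= `|x - y|.
Proof.
move=> k0 sep cx cy uv uvn.
have [x' [Kx' ->]] := cx n.+1; have [y' [Ky' ->]] := cy n.+1.
rewrite !mkseqS !word_map_rcons.
have -> : mkseq v n = mkseq u n.
  by apply/eq_in_map => k; rewrite mem_iota /= => /uv.
rewrite word_mapB normrM normfV normr_nat; apply: ler_pM.
- exact: ltW.
- by rewrite invr_ge0 exprn_ge0.
- by apply: sep => //; apply/eqP.
- have d0 := word_den_gt0 (mkseq u n).
  have /andP[_ h] := word_den_bounds (mkseq u n); rewrite size_mkseq in h.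
  by rewrite -natrX lef_pV2 ?posrE ?ltr0n // ?ler_nat // (leq_trans d0 h).
Qed.

(** The fixed point b / (Q - 1) is rational; it lies in K because the point of
    K coded by the constant sequence is within C / 2^n of it for every n. *)
Lemma rational_fixed_point (i : I) :
  exists r : rat, K (ratr r) /\ affine (Q i) (b i) (ratr r) = ratr r :> R.
Proof.
have Qi2 : (2 <= Q i)%N by have /andP[h _] := QAB i; exact: leq_trans h.
pose r : rat := (b i)%:~R / ((Q i)%:R - 1); exists r.
have fixr : affine (Q i) (b i) r = r.
  have q0 : (Q i)%:R != 0 :> rat by rewrite pnatr_eq0 -lt0n ltnW.
  have q1 : (Q i)%:R - 1 != 0 :> rat by rewrite subr_eq0 pnatr_eq1; case: (Q i) Qi2 => [|[]].
  by rewrite /affine /r; field; rewrite q0 q1.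
have fixR : affine (Q i) (b i) (ratr r) = ratr r :> R.
  by have := ratr_word_map Q b [:: i] r => /= /(_ R); rewrite /= fixr.
split=> //.
have [x cx] := exists_coded (fun=> i).
have Kx := coded_in cx.
suff -> : ratr r = x by [].
apply/eqP; rewrite eq_sym -subr_eq0 -normr_le0.
pose C := Dm + `|x - ratr r|.
have le_C n : `|x - ratr r| <= C / 2 ^+ n.
  have [y [Ky xE]] := cx n.
  have rE : ratr r = word_map Q b (mkseq (fun=> i) n) (ratr r) :> R.
    by elim: n {xE} => // n IH; rewrite mkseqS word_map_rcons fixR.
  rewrite {1}xE {1}rE word_mapB normrM normfV normr_nat.
  have d0 := word_den_gt0 (mkseq (fun=> i) n).
  apply: ler_pM => //.
    rewrite /C (_ : y - _ = (y - x) + (x - ratr r)); last by ring.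
    by rewrite (le_trans (ler_normD _ _)) // lerD2r KD.
  have /andP[h _] := word_den_bounds (mkseq (fun=> i) n); rewrite size_mkseq in h.
  rewrite -natrX lef_pV2 ?posrE ?ltr0n ?word_den_gt0 ?expn_gt0 // ler_nat.
  by apply: leq_trans h; case: (n) => // k; rewrite leq_exp2r.
rewrite leNgt; apply/negP => pos.
pose n := (Num.truncn (C / `|x - ratr r|)).+1.
have := le_C n; rewrite ler_pdivlMr ?exprn_gt0 // mulrC -ler_pdivlMr //.
apply/negP; rewrite -ltNge; apply: (lt_le_trans (truncnS_gt _)).
by rewrite -natrX ler_nat ltnW // ltn_expl.
Qed.

End Codes.

(** * Sparse blocks of forced digits *)

Section Blocks.
Context {R : realType}.

Definition in_block (start stop : nat -> nat) (k : nat) : bool :=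
  [exists j : 'I_k.+1, start j <= k < stop (start j)]%N.

Definition free_count (start stop : nat -> nat) (n : nat) : nat :=
  (\sum_(0 <= k < n) ~~ in_block start stop k)%N.

(** Blocks run from a good start to at most lambda times that start.  When a
    start is much larger than the end of the preceding block, almost all
    positions before it are free, so even at the end of the block the free
    positions make up about 1 / lambda of all positions. *)
Lemma sparse_blocks (good : nat -> Prop) (stop : nat -> nat) (lambda eta : R) :
  (forall m, exists n, (m <= n)%N /\ good n) -> 1 <= lambda -> 0 < eta ->
  (forall n, good n -> (n < stop n)%N /\ (stop n)%:R <= lambda * n%:R) ->
  exists start, [/\ forall j, good (start j),
    forall j k, (j < k)%N -> (stop (start j) <= start k)%N &
    forall n, n%:R <= (1 + eta) * lambda * (free_count start stop n)%:R].
Proof.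
move=> /choice[f fP] lam1 eta0 stopP.
(* C * E j <= start j makes E j negligible: (1 + eta) E j <= eta start j. *)
pose C := (Num.truncn ((1 + eta) / eta)).+1.
pose E := fix E j := if j is j'.+1 then stop (f (C * E j')%N) else 0%N.
pose start j := f (C * E j)%N.
have good_start j : good (start j) by have [] := fP (C * E j)%N.
have CE j : (C * E j <= start j)%N by have [] := fP (C * E j)%N.
have E_start j : (E j <= start j)%N by apply: leq_trans (CE j); rewrite leq_pmull.
have start_E j : (start j < E j.+1)%N by have [] := stopP _ (good_start j).
have E_gap j : (1 + eta) * (E j)%:R <= eta * (start j)%:R.
  have : (1 + eta) / eta * (E j)%:R <= (start j)%:R.
    apply: le_trans (_ : (C * E j)%:R <= _); last by rewrite ler_nat.
    by rewrite natrM ler_wpM2r // ltW // truncnS_gt.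
  by rewrite mulrAC ler_pdivrMr // [leRHS]mulrC.
have E_mono : {homo E : i j / (i <= j)%N}.
  by apply: homo_leq => // [y x z|i]; [exact: leq_trans|exact/ltnW/(leq_ltn_trans (E_start i))].
exists start; split=> // [j k jk|n].
  by apply: leq_trans (E_start k); apply: (E_mono j.+1).
pose phi := free_count start stop.
have phi_mono : {homo phi : i j / (i <= j)%N}.
  apply: homo_leq => // [y x z|k]; first exact: leq_trans.
  by rewrite /phi /free_count big_nat_recr //= leq_addr.
have freeE j k : (E j <= k < start j)%N -> in_block start stop k = false.
  move=> /andP[Ek ks]; apply/negbTE/negP => /existsP[i /andP[si sk]].
  have [ij|ji] := ltnP i j.
    by have := E_mono i.+1 j ij; rewrite leqNgt (leq_ltn_trans Ek).
  have : (start j <= start i)%N.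
    have [->|] := eqVneq (i : nat) j; first by [].
    move=> ne; have ji' : (j < i)%N by rewrite ltn_neqAle eq_sym ne.
    exact: leq_trans (ltnW (start_E j)) (leq_trans (E_mono j.+1 i ji') (E_start i)).
  by rewrite leqNgt (leq_ltn_trans si).
have phiD j k : (E j <= k <= start j)%N -> phi k = (phi (E j) + (k - E j))%N.
  move=> /andP[Ek ks]; rewrite /phi /free_count (@big_cat_nat _ _ _ (E j)) //=.
  congr (_ + _)%N; rewrite -[RHS]muln1 -[in RHS]sum_nat_const_nat.
  apply: eq_big_nat => i /andP[Ei ik].
  by rewrite (freeE j) // Ei (leq_trans ik).
have lam0 : 0 <= lambda by exact: le_trans lam1.
pose L := (1 + eta) * lambda.
have L1 : 1 <= L by rewrite /L -[leLHS]mulr1 ler_pM // lerDl ltW.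
(* Position k is treated by induction on the number j of blocks around it:
   either before E j, or in the free gap up to start j, or in the next block. *)
suff h j k : (k <= E j)%N -> k%:R <= L * (phi k)%:R.
  apply: (h n); elim: (n) => // i IH.
  exact: leq_ltn_trans IH (leq_ltn_trans (E_start i) (start_E i)).
elim: j k => [|j IH] k kE.
  by move: kE; rewrite leqn0 => /eqP ->; rewrite mulr_ge0 // (le_trans ler01).
have [kEj|Ejk] := leqP k (E j); first exact: IH.
have step i : (E j <= i <= start j)%N -> (phi i)%:R = (phi (E j))%:R + (i%:R - (E j)%:R) :> R.
  by move=> h; rewrite (phiD j) // natrD natrB //; case/andP: h.
have [ks|sk] := leqP k (start j).
  have := IH _ (leqnn (E j)).
  rewrite (step k) ?(ltnW Ejk) //.
  have : (E j)%:R <= k%:R :> R by rewrite ler_nat ltnW.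
  by set a := _%:R; set c := phi _; nra.
have [_ hs] := stopP _ (good_start j).
apply: (@le_trans _ _ (lambda * (start j)%:R)).
  by apply: le_trans hs; rewrite ler_nat.
apply: (@le_trans _ _ (L * (phi (start j))%:R)); last first.
  by rewrite ler_wpM2l ?(le_trans ler01) // ler_nat phi_mono // ltnW.
rewrite (step (start j)) ?E_start ?leqnn // /L -mulrA [leRHS]mulrCA ler_wpM2l //.
have := E_gap j; have : 0 <= (phi (E j))%:R :> R by [].
by set a := _%:R => a0; nra.
Qed.

End Blocks.

Section ForcedDigits.
Context {R : realType} {I : finType}.
Variables (start stop : nat -> nat) (digit : nat -> nat -> I).

(** The conjunction of the constraints of all blocks around k, hence a single
    digit when k lies in one of the disjoint blocks and all digits otherwise.
    Only the blocks j <= k are consulted, which keeps the condition decidable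
    and loses nothing when starts satisfy j <= start j. *)
Definition forced_digits (k : nat) : {set I} :=
  [set i | [forall j : 'I_k.+1, (start j <= k < stop (start j))%N ==>
    (i == digit (start j) k)]].

Lemma forced_digits_neq0 (i0 : I) :
  (forall j k, (j < k)%N -> (stop (start j) <= start k)%N) ->
  forall k, forced_digits k != finset.set0.
Proof.
move=> disj k; apply/set0Pn.
have [/existsP[j jk]|nblock] := boolP (in_block start stop k); last first.
  exists i0; rewrite inE; apply/forallP => j; apply/implyP => jk.
  by case/negP: nblock; apply/existsP; exists j.
exists (digit (start j) k); rewrite inE; apply/forallP => i; apply/implyP => ik.
suff -> : val i = val j by [].
move: jk ik => /andP[j1 j2] /andP[i1 i2]; have [ij|ji|//] := ltngtP (val i) (val j).
- by have := leq_trans (leq_trans i2 (disj _ _ ij)) j1; rewrite ltnn.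
- by have := leq_trans (leq_trans j2 (disj _ _ ji)) i1; rewrite ltnn.
Qed.

Lemma forced_digitsP u j k : (j <= start j)%N -> admissible forced_digits u ->
  (start j <= k < stop (start j))%N -> u k = digit (start j) k.
Proof.
move=> js uD jk; have := uD k; rewrite inE => /forallP.
have jk1 : (j < k.+1)%N by rewrite ltnS (leq_trans js) //; case/andP: jk.
by move=> /(_ (Ordinal jk1)) /implyP /(_ jk) /eqP.
Qed.

Lemma forced_digits_weight n :
  (forall k, forced_digits k != finset.set0) ->
  branch_weight forced_digits n <= (#|I|%:R ^+ free_count start stop n)^-1 :> R.
Proof.
move=> D0; rewrite /branch_weight /free_count
  -(big_mkord xpredT (fun k => #|forced_digits k|%:R^-1)).
elim: n => [|n IH]; first by rewrite !big_geq // expr0 invr1.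
rewrite !big_nat_recr //= exprD invfM; apply: ler_pM => //.
- by apply: prodr_ge0 => i _; rewrite invr_ge0.
have D1 : 0 < #|forced_digits n|%:R :> R by rewrite ltr0n card_gt0.
have [nb|nb] := boolP (in_block start stop n).
  by rewrite expr0 invr1 invf_le1 // ler1n -(ltr0n R).
rewrite expr1 (_ : forced_digits n = finset.setT) ?cardsT //.
apply/setP => i; rewrite !inE; apply/forallP => j; apply/implyP => jk.
by case/negP: nb; apply/existsP; exists j.
Qed.

End ForcedDigits.

(** * Levels at which the approximation function is large *)

Section ApproximationFunction.
Context {R : realType}.
Variable psi : nat -> R.
Hypothesis psi_ge0 : forall n, (0 < n)%N -> 0 <= psi n.
Hypothesis psi_noninc : forall n k, (0 < n)%N -> (n <= k)%N -> psi k <= psi n.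

Lemma delta_lt_frequently (t : R) : (delta psi < t%:E)%E ->
  forall n0, exists N, (n0 <= N)%N /\ (N%:R `^ t)^-1 <= psi N.
Proof.
rewrite /delta; set v := (X in limn_einf X) => dt n0.
have supE : limn_einf v = ereal_sup (range (einfs v)).
  rewrite limn_einf_lim; apply/cvg_lim; first exact: ereal_hausdorff.
  exact: cvg_einfs_sup.
have : (einfs v (maxn n0 2) < t%:E)%E.
  apply: le_lt_trans dt; rewrite supE; apply: ereal_sup_ubound.
  by exists (maxn n0 2).
rewrite /einfs /= => /ereal_inf_lt[_ [N /= + <-]].
rewrite geq_max => /andP[n0N N2] vN; exists N; split=> //.
have lnN : 0 < ln N%:R :> R by rewrite ln_gt0 // ltr1n.
have N0 : 0 < N%:R :> R by rewrite ltr0n ltnW.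
move: vN; rewrite /v inver gt_eqF //.
have [psi0|psiN0] := eqVneq (psi N) 0.
  by rewrite psi0 /lne lexx /= gt0_mulye ?lte_fin ?invr_gt0 //.
have psi_gt0 : 0 < psi N by rewrite lt_def psiN0 psi_ge0 // ltnW.
rewrite /lne leNgt psi_gt0 /= -EFinM lte_fin ltr_pdivrMr // => h.
rewrite /powR gt_eqF // -expRN -[leRHS]lnK // ler_expR; lra.
Qed.

(** N is squeezed between d B^n and d B^(n+1); since psi is non-increasing, its
    value at N bounds from below all its values up to d B^n, that is, at the
    denominators of all rationals obtained from words of length n. *)
Lemma good_levels (t : R) (d B : nat) : 0 <= t ->
  (forall n0, exists N, (n0 <= N)%N /\ (N%:R `^ t)^-1 <= psi N) ->
  (0 < d)%N -> (2 <= B)%N ->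
  forall m, exists n, (m <= n)%N /\ forall k, (0 < k <= d * B ^ n)%N ->
    ((d * B ^ n.+1)%:R `^ t)^-1 <= psi k.
Proof.
move=> t0 freq d0 B2 m; have [N [mN psiN]] := freq (d * B ^ m)%N.
have B0 : (0 < B)%N by exact: ltnW.
have exn : exists n, (N < d * B ^ n.+1)%N.
  exists N; rewrite (leq_trans (ltnW (ltn_expl N.+1 B2))) //.
  by rewrite leq_pmull.
case: (ex_minnP exn) => n nN nmin.
have dBN : (d * B ^ n <= N)%N.
  case: n nN nmin => [|n] _ nmin.
    by apply: leq_trans mN; rewrite leq_mul2l expn0 expn_gt0 B0 orbT.
  by rewrite leqNgt; apply/negP => /nmin; rewrite ltnn.
exists n; split.
  have : (d * B ^ m < d * B ^ n.+1)%N by exact: leq_ltn_trans nN.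
  by rewrite ltn_pmul2l // ltn_exp2l.
move=> k /andP[k0 kd]; have kN := leq_trans kd dBN.
have N0 : (0 < N)%N by exact: leq_trans kN.
apply: le_trans (psi_noninc k0 kN); apply: le_trans psiN.
rewrite lef_pV2 ?posrE ?powR_gt0 ?ltr0n ?muln_gt0 ?d0 ?expn_gt0 ?B0 //.
by rewrite ge0_ler_powR ?nnegrE // ler_nat ltnW.
Qed.

End ApproximationFunction.

(** * Choice of the exponents *)

Section Exponents.
Context {R : realType}.
Variables (A B : nat) (eta t : R).
Hypothesis A_ge2 : (2 <= A)%N.
Hypothesis B_ge2 : (2 <= B)%N.
Hypothesis AB : B%:R <= A%:R `^ (1 + eta) :> R.
Hypothesis eta0 : 0 < eta.
Hypothesis t1 : 1 <= t.

Let A1 : 1 <= A%:R :> R. Proof. by rewrite ler1n ltnW. Qed.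
Let A0 : 0 < A%:R :> R. Proof. by rewrite ltr0n ltnW. Qed.

Lemma powR_scale_le (x : R) (n : nat) : 0 <= x ->
  (B%:R ^+ n) `^ x <= A%:R `^ ((1 + eta) * n%:R * x).
Proof.
move=> x0; rewrite -powR_mulrn ?ler0n // -powRrM.
rewrite -mulrA [leRHS]powRrM; apply: ge0_ler_powR => //.
all: by rewrite ?nnegrE ?powR_ge0 ?mulr_ge0 ?ler0n.
Qed.

(** Ending a block that starts at n at about (1 + eta)^2 t n makes the piece of
    K at the last position smaller than (d B^(n+1))^-t: one factor 1 + eta pays
    for B <= A^(1 + eta), the other absorbs all constants for n large. *)
Lemma block_length_bounds (d : nat) (Dm : R) : (0 < d)%N ->
  let stop n := Num.truncn ((1 + eta) ^+ 2 * t * n%:R) in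
  exists n0, forall n, (n0 <= n)%N -> [/\ (n.+1 < stop n)%N,
    (stop n)%:R <= (1 + eta) ^+ 2 * t * n%:R &
    Dm / A%:R ^+ (stop n).-1 <= ((d * B ^ n.+1)%:R `^ t)^-1].
Proof.
move=> d0 stop.
have [e0 t_ge1] := (eta0, t1); have t0 : 0 <= t by exact: le_trans t1.
have [l hl] : exists l : nat, Dm * d%:R `^ t <= A%:R ^+ l.
  exists (Num.truncn (Dm * d%:R `^ t)).+1.
  apply: le_trans (ltW (truncnS_gt _)) _; rewrite -natrX ler_nat.
  exact: ltnW (ltn_expl _ _).
exists (Num.truncn ((l%:R + 3 + (1 + eta) * t) / eta)).+1 => n nn.
have hn : l%:R + 3 + (1 + eta) * t <= eta * n%:R.
  rewrite [leRHS]mulrC -ler_pdivrMr //.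
  by apply: le_trans (ltW (truncnS_gt _)) _; rewrite ler_nat.
have l0 : 0 <= l%:R :> R by [].
have n0 : 0 <= n%:R :> R by [].
have et1 : 1 + eta <= (1 + eta) * t.
  by rewrite -{1}[1 + eta]mulr1 ler_wpM2l //; lra.
have lamn : eta * n%:R + n%:R <= (1 + eta) * t * n%:R.
  by rewrite -{2}[n%:R]mul1r -mulrDl ler_wpM2r //; lra.
have lamn2 : (1 + eta) * t * n%:R + eta * n%:R <= (1 + eta) ^+ 2 * t * n%:R.
  rewrite -mulrDl ler_wpM2r //.
  have -> : (1 + eta) ^+ 2 * t = (1 + eta) * t + eta * ((1 + eta) * t) by ring.
  rewrite lerD2l.
  by rewrite -{1}[eta]mulr1 ler_wpM2l ?ltW //; lra.
have et : 0 <= (1 + eta) * t by lra.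
have stop_gt : (1 + eta) ^+ 2 * t * n%:R < (stop n)%:R + 1.
  by rewrite natr1; exact: truncnS_gt.
have stop_big : (n.+1 < stop n)%N.
  by rewrite -(ltr_nat R) -natr1; lra.
split=> //; first by rewrite truncn_le !mulr_ge0 ?exprn_ge0 //; lra.
have lp : (stop n).-1%:R = (stop n)%:R - 1 :> R.
  by rewrite -subn1 natrB // (leq_trans _ stop_big).
have dB0 : 0 < (d * B ^ n.+1)%:R :> R.
  by rewrite ltr0n muln_gt0 d0 expn_gt0 (ltnW B_ge2).
rewrite ler_pdivrMr ?exprn_gt0 // mulrC ler_pdivlMr ?powR_gt0 //.
rewrite natrM powRM ?ler0n // mulrA.
apply: (@le_trans _ _ (A%:R ^+ l * A%:R `^ ((1 + eta) * n.+1%:R * t))).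
  apply: le_trans (_ : A%:R ^+ l * (B ^ n.+1)%:R `^ t <= _).
    by rewrite ler_wpM2r // powR_ge0.
  by rewrite ler_wpM2l ?exprn_ge0 // natrX powR_scale_le.
rewrite -!powR_mulrn ?ler0n // -powRD ?(gt_eqF A0) ?implybT //.
by rewrite ler_powR // lp -natr1; nra.
Qed.

(** The four factors 1 + eta: one for B <= A^(1 + eta), two for the length of
    the blocks, one for their sparsity. *)
Lemma weight_exponent_le (M n phi : nat) (s s2 : R) : 0 <= s ->
  A%:R `^ s2 <= M%:R :> R -> (1 + eta) ^+ 4 * t * s <= s2 ->
  n%:R <= (1 + eta) * ((1 + eta) ^+ 2 * t) * phi%:R ->
  (M%:R ^+ phi)^-1 <= ((B%:R ^+ n) `^ s)^-1 :> R.
Proof.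
move=> s0 AM sle nphi.
have e0 := eta0; have M0 : 0 < M%:R :> R by apply: lt_le_trans AM; exact: powR_gt0.
rewrite lef_pV2 ?posrE ?exprn_gt0 ?powR_gt0 ?exprn_gt0 ?ltr0n ?(ltnW B_ge2) -?(ltr0n R) //.
apply: le_trans (powR_scale_le n s0) _.
apply: (@le_trans _ _ (A%:R `^ (s2 * phi%:R))).
  apply: ler_powR => //; apply: (@le_trans _ _ ((1 + eta) ^+ 4 * t * s * phi%:R)).
    have -> : (1 + eta) ^+ 4 * t * s * phi%:R =
      (1 + eta) * ((1 + eta) * ((1 + eta) ^+ 2 * t) * phi%:R) * s by ring.
    by rewrite ler_wpM2r // ler_wpM2l // ; lra.
  by rewrite ler_wpM2r.
rewrite powRrM -powR_mulrn ?ler0n //.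
by apply: ge0_ler_powR; rewrite ?nnegrE ?powR_ge0 ?ler0n.
Qed.

End Exponents.

(** * The approximable set *)

Section ApproximableSet.
Context {R : realType}.

Lemma dist_rat_lower_bound (x : R) (s : seq rat) :
  exists2 e : R, 0 < e & {in s, forall r, ratr r != x -> e <= `|x - ratr r|}.
Proof.
elim: s => [|r s [e e0 he]]; first by exists 1.
have [rx|rx] := eqVneq (ratr r) x.
  exists e => // r'; rewrite inE => /orP[/eqP->|/he //].
  by rewrite rx eqxx.
exists (Num.min e `|x - ratr r|).
  by rewrite lt_min e0 normr_gt0 subr_eq0 eq_sym.
move=> r'; rewrite inE ge_min => /orP[/eqP-> _|r's hr']; first by rewrite lexx orbT.
by rewrite he.
Qed.

(** A finite set of rationals other than x stays at a positive distance
    from x. *)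
Lemma infinite_rat_approximations (x : R) (S : set rat) (r : nat -> rat) (C : R) :
  (forall j, S (r j)) -> (forall j, ratr (r j) != x) ->
  (forall j, `|x - ratr (r j)| <= C / 2 ^+ j) -> infinite_set S.
Proof.
move=> Sr rx rC /finite_seqP[s SE].
have [e e0 he] := dist_rat_lower_bound x s.
pose j := (Num.truncn (C / e)).+1.
have rjs : r j \in s by have := Sr j; rewrite SE.
have := le_trans (he _ rjs (rx j)) (rC j).
rewrite ler_pdivlMr ?exprn_gt0 // mulrC -ler_pdivlMr //.
apply/negP; rewrite -ltNge; apply: (lt_le_trans (truncnS_gt _)).
by rewrite -natrX ler_nat ltnW // ltn_expl.
Qed.

Lemma exists_small_factor (a c : R) : 0 <= a -> a < c ->
  exists2 eta : R, 0 < eta & (1 + eta) ^+ 4 * a <= c.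
Proof.
move=> a0 ac; pose eta := Num.min 1 ((c - a) / (15 * a + 1)).
have den0 : 0 < 15 * a + 1 by lra.
have eta0 : 0 < eta by rewrite lt_min ltr01 divr_gt0 // subr_gt0.
have eta1 : eta <= 1 by rewrite ge_min lexx.
exists eta => //.
have : eta * (15 * a + 1) <= c - a by rewrite -ler_pdivlMr // ge_min lexx orbT.
have : (1 + eta) ^+ 4 <= 1 + 15 * eta.
  have e2 : eta ^+ 2 <= eta by rewrite expr2 ler_piMr // ltW.
  have e3 : eta ^+ 3 <= eta by rewrite exprS ler_piMr ?(ltW eta0) // expr_le1 // ltW.
  have e4 : eta ^+ 4 <= eta by rewrite exprS ler_piMr ?(ltW eta0) // expr_le1 // ltW.
  have -> : (1 + eta) ^+ 4 = 1 + 4 * eta + 6 * eta ^+ 2 + 4 * eta ^+ 3 + eta ^+ 4 by ring.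
  lra.
by move=> h1 h2; have := ler_wpM2r a0 h1; lra.
Qed.

Section Approximable.
Variables (m : nat) (q : 'I_m -> nat) (p : 'I_m -> int) (K : set R).
Hypothesis q_ge2 : forall i, (2 <= q i)%N.
Hypothesis hK : is_attractor (ifs q p) K.
Variable psi : nat -> R.
Hypothesis psi_noninc : forall n k, (0 < n)%N -> (n <= k)%N -> psi k <= psi n.

(** The Cantor set of codes with forced blocks: i0 is the digit of the rational
    fixed point r0, and i1 another digit.  At the last position l j of block j
    but for the final digit, the point pt u and the rational r j, image of r0
    under the prefix before the block, have the same prefix, so they are close;
    the final digit i1 makes them differ. *)
Lemma approximable_measure_neq0 (t s s1 : R) : 1 <= t -> 0 <= s ->
  (forall n0, exists N, (n0 <= N)%N /\ (N%:R `^ t)^-1 <= psi N) ->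
  s * t < s1 -> (s1%:E < hausdorff_dim K)%E ->
  hausdorff_measure s (intrinsically_approximable psi K) <> 0%E.
Proof.
move=> t_ge1 s0 freq st1 s1K.
have [K0 Kc _] := hK.
have t0 : 0 <= t by exact: le_trans t_ge1.
have st0 : 0 <= t * s by exact: mulr_ge0.
have [Dm Dm0 KD] : exists2 Dm : R, 0 < Dm & forall x y, K x -> K y -> `|x - y| <= Dm.
  have [C [_ KC]] := compact_bounded Kc.
  have C1 : C < `|C| + 1 by rewrite ltr_pwDr // ler_norm.
  exists (2 * (`|C| + 1)); first by rewrite mulr_gt0 // ltr_pwDr.
  move=> x y Kx Ky; rewrite (le_trans (ler_normB _ _)) // mulr_natl mulr2n.
  by rewrite lerD // KC.
pose s2 := (t * s + s1) / 2.
have [s2_gt s2_lt] : t * s < s2 /\ s2 < s1 by rewrite /s2; split; lra.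
have s2_0 : 0 <= s2 by rewrite ltW // (le_lt_trans st0).
have [eta eta0 heta] := exists_small_factor st0 s2_gt.
have [A [B [M [Q [b [kappa [/andP[A2 AB] BA [M2 AM] QAB [kappa0 sep]]]]]]]] :=
  separated_subsystem q_ge2 hK s2_0 s2_lt s1K eta0 Dm0 KD.
have B2 : (2 <= B)%N by exact: leq_trans AB.
have QB i : (A <= Q i <= B)%N by have [] := QAB i.
have stab i x : K x -> K (affine (Q i) (b i) x) by have [_] := QAB i; apply.
have Q0 := ratio_gt0 A2 QB.
pose i0 : 'I_M := Ordinal (ltnW M2); pose i1 : 'I_M := Ordinal M2.
have [r0 [Kr0 fixr0]] := rational_fixed_point K0 Kc KD A2 QB stab i0.
pose d := `|denq r0|%N.
have d0 : (0 < d)%N by rewrite absz_gt0 denq_neq0.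
pose lambda := (1 + eta) ^+ 2 * t.
pose stop n := Num.truncn (lambda * n%:R).
have [n0 hn0] := block_length_bounds A2 B2 BA eta0 t_ge1 Dm d0.
pose good n := (n0 <= n)%N /\ forall k, (0 < k <= d * B ^ n)%N ->
    ((d * B ^ n.+1)%:R `^ t)^-1 <= psi k.
have good_inf l : exists n, (l <= n)%N /\ good n.
  have [n [ln hn]] := good_levels psi_noninc t0 freq d0 B2 (maxn l n0).
  by move: ln; rewrite geq_max => /andP[ln nn]; exists n.
have lambda1 : 1 <= lambda.
  by rewrite /lambda -[leLHS]mulr1 ler_pM // expr_ge1 ?lerDl // ?addr_ge0 // ltW.
have [|start [start_good disj count_le]] := sparse_blocks (stop := stop) good_inf lambda1 eta0.
  by move=> n [nn _]; have [h1 h2 _] := hn0 n nn; split=> //; exact: ltnW.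
have start_ge j : (j <= start j)%N.
  elim: j => // j IH; apply: (leq_ltn_trans IH); apply: leq_trans (disj _ _ (ltnSn j)).
  by have [nn _] := start_good j; have [h _ _] := hn0 _ nn; exact: ltnW.
pose digit n k := if k.+1 == stop n then i1 else i0.
pose D := forced_digits start stop digit.
have D0 : forall k, D k != finset.set0 by exact: forced_digits_neq0.
have weight n : branch_weight D n <= (M%:R ^+ free_count start stop n)^-1 :> R.
  by have := @forced_digits_weight R _ start stop digit n D0; rewrite card_ord.
have /choice[pt ptP] := exists_coded K0 Kc stab.
apply: (@hausdorff_measure_neq0 R _ D pt _ B kappa s) => //.
- move=> u v n uD vD uv uvn.
  exact: (coded_separated A2 QB kappa0 sep (ptP u) (ptP v) uv uvn).
- move=> u uD; split; first exact: coded_in (ptP u).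
  pose r j := word_map Q b (mkseq u (start j)) r0.
  pose l j := (stop (start j)).-1.
  have ratrE j : ratr (r j) = word_map Q b (mkseq u (start j)) (ratr r0) :> R.
    by rewrite ratr_word_map.
  have bounds j : [/\ (start j < l j)%N, (l j).+1 = stop (start j) &
      Dm / A%:R ^+ l j <= ((d * B ^ (start j).+1)%:R `^ t)^-1].
    have [nn _] := start_good j; have [h _ h'] := hn0 _ nn.
    have stop_gt0 : (0 < stop (start j))%N by exact: leq_ltn_trans h.
    by split=> //; rewrite ?prednK // -ltnS /l prednK.
  (* r0 is fixed by the map i0, so lengthening the prefix inside the block does
     not move the rational. *)
  have zeros j k : (start j <= k <= l j)%N ->
      ratr (r j) = word_map Q b (mkseq u k) (ratr r0) :> R.
    have [_ lE _] := bounds j.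
    elim: k => [|k IH] /andP[sk kl]; first by rewrite ratrE; move: sk; rewrite leqn0 => /eqP->.
    move: sk; rewrite leq_eqVlt => /orP[/eqP<-|sk]; first exact: ratrE.
    rewrite mkseqS word_map_rcons.
    have -> : u k = i0.
      rewrite (forced_digitsP (start_ge j) uD) /digit; last by rewrite -lE ltnS (ltnW kl) -ltnS sk.
      by rewrite -lE eqSS ltn_eqF.
    by rewrite fixr0 IH // -ltnS sk ltnW.
  have close j : `|pt u - ratr (r j)| <= Dm / A%:R ^+ l j.
    have [sl _ _] := bounds j; have [y [Ky ->]] := ptP u (l j).
    rewrite (zeros j (l j)) ?(ltnW sl) ?leqnn //.
    by have := word_map_close b KD A2 QB (mkseq u (l j)) Ky Kr0; rewrite size_mkseq.
  apply: (@infinite_rat_approximations (pt u) _ r Dm).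
  + move=> j; split; first by rewrite ratrE; exact: word_map_stable.
    have [_ hpsi] := start_good j; have [_ _ hl] := bounds j.
    apply: le_trans (close j) (le_trans hl _); apply: hpsi.
    rewrite absz_gt0 denq_neq0 /= (leq_trans (denq_word_map b _ r0 Q0)) // leq_mul2l.
    have /andP[_ +] := word_den_bounds QB (mkseq u (start j)).
    by rewrite size_mkseq => ->; rewrite orbT.
  + move=> j; have [sl lE _] := bounds j.
    have [y [Ky xE]] := ptP u (l j).+1.
    rewrite (zeros j (l j)) ?(ltnW sl) ?leqnn // -fixr0 {}xE.
    rewrite mkseqS word_map_rcons.
    have -> : u (l j) = i1.
      rewrite (forced_digitsP (start_ge j) uD) /digit ?lE ?eqxx //.
      by rewrite (ltnW sl) -lE leqnn.
    rewrite -subr_eq0 word_mapB mulf_eq0 negb_or invr_eq0 pnatr_eq0 -lt0n.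
    rewrite (word_den_gt0 A2 QB) andbT -normr_gt0.
    by apply: lt_le_trans kappa0 _; exact: sep.
  + move=> j; apply: le_trans (close j) _; apply: ler_pM => //.
      exact: ltW.
    have [sl _ _] := bounds j.
    rewrite -!natrX lef_pV2 ?posrE ?ltr0n ?expn_gt0 ?(ltnW A2) // ler_nat.
    apply: (@leq_trans (2 ^ l j)%N).
      by rewrite leq_exp2l // (leq_trans (start_ge j)) // ltnW.
    by case: (l j) => // k; rewrite leq_exp2r.
- move=> n; apply: le_trans (weight n) _.
  by apply: (weight_exponent_le A2 B2 BA eta0 s0 AM _ (count_le n)); rewrite -mulrA.
- move=> e e0.
  pose L := (1 + eta) * lambda.
  have L0 : 0 < L by rewrite mulr_gt0 ?(lt_le_trans ltr01 lambda1) // ltr_pwDl // ltW.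
  pose k := (Num.truncn e^-1).+1; pose n := (Num.truncn (L * k%:R)).+1.
  exists n; apply: le_trans (weight n) _.
  have kc : (k <= free_count start stop n)%N.
    rewrite -(ler_nat R) -(ler_pM2l L0); apply: le_trans (count_le n).
    exact: ltW (truncnS_gt _).
  rewrite -[leRHS]invrK lef_pV2 ?posrE ?invr_gt0 ?exprn_gt0 ?ltr0n ?(ltnW M2) //.
  apply: le_trans (ltW (truncnS_gt _)) _; rewrite -natrX ler_nat.
  exact: leq_trans kc (ltnW (ltn_expl _ M2)).
Qed.

End Approximable.

(** Room for two exponents: t above r, to have infinitely many good N, and s1
    below the dimension, to lose a little in the subsystem. *)
Lemma exponent_between (s r : R) (x : \bar R) : 0 <= s -> 1 <= r ->
  ((s * r)%:E < x)%E ->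
  exists t s1 : R, [/\ r < t, s * t < s1 & (s1%:E < x)%E].
Proof.
move=> s0 r1 sx.
have [s1 s1_gt s1x] : exists2 s1 : R, s * r < s1 & (s1%:E < x)%E.
  case: x sx => [x| |] //; rewrite ?lte_fin => sx.
    by exists ((s * r + x) / 2); rewrite ?lte_fin; lra.
  by exists (s * r + 1); rewrite ?ltrDl // ltry.
exists (r + (s1 - s * r) / (s + 1)), s1; split=> //.
  by rewrite ltrDl divr_gt0 ?subr_gt0 // ltr_wpDl.
rewrite mulrDr -ltrBrDl mulrA ltr_pdivrMr ?ltr_wpDl //; nra.
Qed.

End ApproximableSet.

Theorem corollary1p9 (R : realType) (m : nat) (hm : (2 <= m)%N)
    (q : 'I_m -> nat) (hq : forall i, (2 <= q i)%N)
    (p : 'I_m -> int)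
    (K : set R) (hK : is_attractor (ifs q p) K)
    (psi : nat -> R)
    (psi_ge0 : forall n, (0 < n)%N -> 0 <= psi n)
    (psi_noninc : forall n k, (0 < n)%N -> (n <= k)%N -> psi k <= psi n) :
  (hausdorff_dim K / maxe 1 (delta psi)
     <= hausdorff_dim (intrinsically_approximable psi K))%E.
Proof.
apply: hausdorff_dim_ge => s s0 H0; rewrite leNgt; apply/negP => lt_s.
have := le_refl (maxe 1%E (delta psi)); rewrite ge_max => /andP[].
case: (maxe 1%E (delta psi)) lt_s => [r| |] // lt_s.
- rewrite lee_fin => r1 delta_r.
  have r0 : 0 < r by exact: lt_le_trans r1.
  have sr : ((s * r)%:E < hausdorff_dim K)%E.
    by move: lt_s; rewrite inver gt_eqF // lte_pdivlMr.
  have [t [s1 [rt st1 s1K]]] := exponent_between s0 r1 sr.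
  apply: (approximable_measure_neq0 hq hK psi_noninc _ s0 _ st1 s1K) H0.
    exact: ltW (le_lt_trans r1 rt).
  apply: delta_lt_frequently => //.
  by apply: le_lt_trans delta_r _; rewrite lte_fin.
- by move: lt_s; rewrite invey mule0 lte_fin ltNge s0.
Qed.
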